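(* Let $\zeta_5=e^{2\pi i/5}$ and write $c_k=\theta[\tfrac15;\tfrac k5]$, $d_k=\theta[\tfrac35;\tfrac k5]$ for $k\in\{1,3,5,7,9\}$ (theta constants, functions of $\tau$). For every $\tau\in\mathbb{H}^2$, $$\theta[1;\tfrac15]=\zeta_5\,\frac{\zeta_5c_9^3d_5+c_3^3d_1}{d_3^3},\qquad \theta[1;\tfrac35]=\frac{-d_7^3c_5+d_9^3c_7}{c_1^3}.$$
   Context: Let $\mathbb{H}^2=\{\tau\in\mathbb{C}:\Im\tau>0\}$. For $(\epsilon,\epsilon')\in\mathbb{R}^2$, $$\theta[\epsilon;\epsilon'](\zeta,\tau)=\sum_{n\in\mathbb{Z}}\exp\Big(2\pi i\Big[\tfrac12\big(n+\tfrac{\epsilon}{2}\big)^2\tau+\big(n+\tfrac{\epsilon}{2}\big)\big(\zeta+\tfrac{\epsilon'}{2}\big)\Big]\Big),$$ and $\theta[\epsilon;\epsilon']=\theta[\epsilon;\epsilon'](0,\tau)$ denotes the theta constant. *)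

(* Defs.v *)
From Stdlib Require Import Reals ZArith.
From Coquelicot Require Import Coquelicot.
Open Scope R_scope.

Definition cexp (z : C) : C :=
  (exp (Re z) * cos (Im z), exp (Re z) * sin (Im z)).

Definition CSeries (u : nat -> C) : C :=
  (Series (fun n => Re (u n)), Series (fun n => Im (u n))).

Definition sumZ (f : Z -> C) : C :=
  Cplus (CSeries (fun n => f (Z.of_nat n)))
        (CSeries (fun n => f (- Z.of_nat (S n))%Z)).

Definition theta_term (eps eps' : R) (zeta tau : C) (n : Z) : C :=
  let m : C := RtoC (IZR n + eps / 2) in
  cexp (Cmult (Cmult (RtoC (2 * PI)) Ci)
        (Cplus (Cmult (Cmult (RtoC (1/2)) (Cmult m m)) tau)
               (Cmult m (Cplus zeta (RtoC (eps' / 2)))))).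

(* theta[eps; eps'](zeta, tau) = sum_{n in Z} exp(2 pi i [ 1/2 (n+eps/2)^2 tau
   + (n+eps/2)(zeta+eps'/2) ]). Absolutely convergent for Im tau > 0. *)
Definition theta (eps eps' : R) (zeta tau : C) : C :=
  sumZ (theta_term eps eps' zeta tau).

Definition thetac (eps eps' : R) (tau : C) : C := theta eps eps' (RtoC 0) tau.

Definition zeta5 : C := cexp (Cmult (RtoC (2 * PI / 5)) Ci).

Definition cube (z : C) : C := Cmult z (Cmult z z).

Definition cth (k : R) (tau : C) : C := thetac (1/5) (k/5) tau.
Definition dth (k : R) (tau : C) : C := thetac (3/5) (k/5) tau.

(* Main.v *)
Require Import Defs.
From Stdlib Require Import Reals ZArith Lra Lia FunctionalExtensionality.
From Coquelicot Require Import Coquelicot.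
Open Scope R_scope.

(** Write Theta a b tau for the theta constant with characteristic [2a; 2b].
    Rotating the summation lattice of a product of two theta series by 45
    degrees expresses Theta x tau * Theta x' tau as a sum of two products of
    theta constants at 2 tau.  For the odd function
    Theta1 x = Theta (x + (1/2, 1/2)) it reads, up to a phase,
    Theta1 (x + y) * Theta1 (x - y) = f x * g y - g x * f y, so the Pluecker
    relation for 2x2 minors yields Weierstrass' three-term identity.  At the
    points x + y, 0, x, y all its products have the shape "cube times a fourth
    factor", and two choices of 5-torsion points x, y give the two relations
    after clearing denominators.

    The denominators do not vanish: the same product formula gives
    Theta a b tau * Theta a (b + 1/2) tau
      = Theta a (2b + 1/2) (2 tau) * Theta 0 (1/2) (2 tau),
    so a zero at tau with |a| < 1/2 would propagate to 2^k tau for every k,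
    where the term n = 0 eventually dominates the series. *)

(** * Two-sided series with a geometric majorant *)

Fixpoint csum (u : nat -> C) (N : nat) : C :=
  match N with
  | O => RtoC 0
  | S k => Cplus (csum u k) (u k)
  end.

(** The N-th window is -N <= n < N, matching the way [sumZ] cuts the integers into n >= 0 and n < 0.
    It is not symmetric, so reflections and shifts produce boundary terms. *)
Fixpoint psumZ (f : Z -> C) (N : nat) : C :=
  match N with
  | O => RtoC 0
  | S k => Cplus (psumZ f k) (Cplus (f (Z.of_nat k)) (f (- Z.of_nat (S k))%Z))
  end.

(** A quantitative form of absolute convergence: tails outside the N-th window are O(r^N), so an
    identity between sums follows from an identity between windows up to an error O(r^N). *)
Definition geom_dom (f : Z -> C) (K r : R) : Prop :=
  forall n, Cmod (f n) <= K * r ^ (Z.abs_nat n).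

Lemma psumZ_split (f : Z -> C) N :
  psumZ f N = Cplus (csum (fun n => f (Z.of_nat n)) N)
                    (csum (fun n => f (- Z.of_nat (S n))%Z) N).
Proof.
  induction N as [|N IH]; cbn [psumZ csum]; [ring|rewrite IH; ring].
Qed.

(** [sum_n] includes the index N, while [csum] stops just before it; hence the correction term. *)
Lemma Re_csum u N : Re (csum u N) = sum_n (fun n => Re (u n)) N - Re (u N).
Proof.
  induction N as [|N IH].
  - rewrite sum_O. simpl. ring.
  - rewrite sum_Sn. cbn [csum]. unfold plus; simpl.
    change (fst (csum u N)) with (Re (csum u N)). rewrite IH. unfold Re. ring.
Qed.

Lemma Im_csum u N : Im (csum u N) = sum_n (fun n => Im (u n)) N - Im (u N).
Proof.
  induction N as [|N IH].
  - rewrite sum_O. simpl. ring.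
  - rewrite sum_Sn. cbn [csum]. unfold plus; simpl.
    change (snd (csum u N)) with (Im (csum u N)). rewrite IH. unfold Im. ring.
Qed.

Lemma ex_series_geom_dom (u : nat -> R) K r :
  0 <= r < 1 -> (forall n, Rabs (u n) <= K * r ^ n) ->
  ex_series (fun n => Rabs (u n)).
Proof.
  intros Hr Hu.
  apply (@ex_series_le R_AbsRing R_CompleteNormedModule) with (fun n => K * r ^ n).
  - intro n. simpl. unfold norm; simpl. unfold abs; simpl.
    rewrite Rabs_Rabsolu. apply Hu.
  - apply (ex_series_scal_l K (fun n => r ^ n)).
    apply ex_series_geom. rewrite Rabs_pos_eq; lra.
Qed.

Lemma Series_geom_tail (u : nat -> R) K r N :
  0 <= r < 1 -> (forall n, Rabs (u n) <= K * r ^ n) ->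
  Rabs (Series u - (sum_n u N - u N)) <= K / (1 - r) * r ^ N.
Proof.
  intros Hr Hu.
  pose proof (ex_series_geom_dom u K r Hr Hu) as Ha.
  pose proof (ex_series_Rabs u Ha) as He.
  assert (Hsh : Series u - (sum_n u N - u N) = Series (fun k => u (N + k)%nat)).
  { destruct N as [|N].
    - rewrite sum_O. rewrite (Series_ext (fun k => u (0 + k)%nat) u); [ring|reflexivity].
    - rewrite (Series_incr_n u (S N)); [|lia|exact He].
      simpl Nat.pred. rewrite sum_Sn. rewrite <- sum_n_Reals. unfold plus; simpl. ring. }
  rewrite Hsh.
  assert (Hu' : forall n, Rabs (u (N + n)%nat) <= (K * r ^ N) * r ^ n).
  { intro n. rewrite Rmult_assoc, <- pow_add. apply Hu. }
  eapply Rle_trans.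
  { apply Series_Rabs. exact (ex_series_geom_dom _ _ _ Hr Hu'). }
  eapply Rle_trans.
  { apply (Series_le _ (fun n => (K * r ^ N) * r ^ n)).
    - intro n. split; [apply Rabs_pos|apply Hu'].
    - apply (ex_series_scal_l (K * r ^ N) (fun n => r ^ n)).
      apply ex_series_geom. rewrite Rabs_pos_eq; lra. }
  rewrite Series_scal_l, Series_geom; [|rewrite Rabs_pos_eq; lra].
  apply Req_le. field. lra.
Qed.

Lemma Cmod_le_Re_Im z : Cmod z <= Rabs (Re z) + Rabs (Im z).
Proof.
  unfold Cmod. apply Rsqr_incr_0_var.
  - rewrite Rsqr_sqrt.
    + pose proof (Rabs_pos (Re z)). pose proof (Rabs_pos (Im z)).
      rewrite <- (pow2_abs (fst z)), <- (pow2_abs (snd z)).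
      fold (Re z) (Im z). unfold Rsqr. nra.
    + pose proof (pow2_ge_0 (fst z)). pose proof (pow2_ge_0 (snd z)). lra.
  - pose proof (Rabs_pos (Re z)). pose proof (Rabs_pos (Im z)). lra.
Qed.

Lemma Rabs_Re_le z : Rabs (Re z) <= Cmod z.
Proof.
  apply Rle_trans with (2 := Rmax_Cmod z). apply Rmax_l.
Qed.

Lemma Rabs_Im_le z : Rabs (Im z) <= Cmod z.
Proof.
  apply Rle_trans with (2 := Rmax_Cmod z). apply Rmax_r.
Qed.

Lemma CSeries_geom_tail (u : nat -> C) K r N :
  0 <= r < 1 -> (forall n, Cmod (u n) <= K * r ^ n) ->
  Cmod (Cminus (CSeries u) (csum u N)) <= 2 * (K / (1 - r)) * r ^ N.
Proof.
  intros Hr Hu.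
  eapply Rle_trans; [apply Cmod_le_Re_Im|].
  assert (H1 : Rabs (Re (Cminus (CSeries u) (csum u N))) <= K / (1 - r) * r ^ N).
  { replace (Re (Cminus (CSeries u) (csum u N)))
      with (Series (fun n => Re (u n)) - Re (csum u N)) by reflexivity.
    rewrite Re_csum.
    apply (Series_geom_tail (fun n => Re (u n))); [exact Hr|].
    intro n. eapply Rle_trans; [apply Rabs_Re_le|apply Hu]. }
  assert (H2 : Rabs (Im (Cminus (CSeries u) (csum u N))) <= K / (1 - r) * r ^ N).
  { replace (Im (Cminus (CSeries u) (csum u N)))
      with (Series (fun n => Im (u n)) - Im (csum u N)) by reflexivity.
    rewrite Im_csum.
    apply (Series_geom_tail (fun n => Im (u n))); [exact Hr|].
    intro n. eapply Rle_trans; [apply Rabs_Im_le|apply Hu]. }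
  lra.
Qed.

Lemma geom_dom_nonneg f K r : geom_dom f K r -> 0 <= K.
Proof.
  intro H. specialize (H 0%Z). simpl in H. pose proof (Cmod_ge_0 (f 0%Z)). lra.
Qed.

(** The constant 4 counts the real and imaginary parts of each of the two half-series. *)
Lemma sumZ_tail f K r N :
  0 <= r < 1 -> geom_dom f K r ->
  Cmod (Cminus (sumZ f) (psumZ f N)) <= 4 * (K / (1 - r)) * r ^ N.
Proof.
  intros Hr Hf. pose proof (geom_dom_nonneg _ _ _ Hf) as HK.
  rewrite psumZ_split. unfold sumZ.
  match goal with |- Cmod (Cminus (Cplus ?a ?b) (Cplus ?c ?d)) <= _ =>
    replace (Cminus (Cplus a b) (Cplus c d)) with (Cplus (Cminus a c) (Cminus b d)) by ring end.
  eapply Rle_trans; [apply Cmod_triangle|].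
  assert (H1 := CSeries_geom_tail (fun n => f (Z.of_nat n)) K r N Hr).
  assert (H2 := CSeries_geom_tail (fun n => f (- Z.of_nat (S n))%Z) K r N Hr).
  assert (H1' := H1 ltac:(intro n; specialize (Hf (Z.of_nat n));
    rewrite Zabs2Nat.id in Hf; exact Hf)).
  assert (H2' : forall n, Cmod (f (- Z.of_nat (S n))%Z) <= K * r ^ n).
  { intro n. specialize (Hf (- Z.of_nat (S n))%Z).
    replace (Z.abs_nat (- Z.of_nat (S n))) with (S n) in Hf by lia.
    simpl in Hf. assert (0 <= r ^ n) by (apply pow_le; lra).
    assert (r * r ^ n <= r ^ n) by nra.
    eapply Rle_trans; [exact Hf|]. apply Rmult_le_compat_l; assumption. }
  specialize (H2 H2'). lra.
Qed.

Lemma geom_le_eq0 x K r : 0 <= r < 1 -> 0 <= x -> (forall N : nat, x <= K * r ^ N) -> x = 0.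
Proof.
  intros Hr Hx H.
  assert (HL : Rbar_le (Finite x) (Finite (K * 0))).
  { apply (is_lim_seq_le (fun _ => x) (fun N => K * r ^ N)); [exact H| |].
    - apply is_lim_seq_const.
    - apply is_lim_seq_mult'; [apply is_lim_seq_const|].
      apply is_lim_seq_geom. rewrite Rabs_pos_eq; lra. }
  simpl in HL. lra.
Qed.

(** Both [s] and the sum lie within O(r^N) of the same window for every N, so their distance is 0.
    Most identities below verify this window estimate for a candidate value. *)
Lemma sumZ_unique f K r K' s :
  0 <= r < 1 -> geom_dom f K r ->
  (forall N, Cmod (Cminus s (psumZ f N)) <= K' * r ^ N) -> s = sumZ f.
Proof.
  intros Hr Hf Hs.
  assert (H0 : Cmod (Cminus s (sumZ f)) = 0).
  { apply geom_le_eq0 with (K := K' + 4 * (K / (1 - r))) (r := r);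
      [exact Hr|apply Cmod_ge_0|].
    intro N.
    replace (Cminus s (sumZ f)) with
      (Cplus (Cminus s (psumZ f N)) (Copp (Cminus (sumZ f) (psumZ f N)))) by ring.
    eapply Rle_trans; [apply Cmod_triangle|]. rewrite Cmod_opp.
    specialize (Hs N). pose proof (sumZ_tail f K r N Hr Hf). lra. }
  apply Cmod_eq_0 in H0.
  replace s with (Cplus (Cminus s (sumZ f)) (sumZ f)) by ring. rewrite H0. ring.
Qed.

Lemma pow_geom_le r (m n : nat) : 0 <= r < 1 -> (m <= n)%nat -> r ^ n <= r ^ m.
Proof.
  intros Hr Hmn. replace n with (m + (n - m))%nat by lia. rewrite pow_add.
  assert (0 <= r ^ m) by (apply pow_le; lra).
  assert (r ^ (n - m) <= 1).
  { rewrite <- (pow1 (n - m)). apply pow_incr. lra. }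
  nra.
Qed.

(** * Linearity, reflection and translation of two-sided sums *)

Lemma sumZ_ext f g : (forall n, f n = g n) -> sumZ f = sumZ g.
Proof.
  intro H. f_equal. apply functional_extensionality. exact H.
Qed.

Lemma psumZ_scal c f N : psumZ (fun n => Cmult c (f n)) N = Cmult c (psumZ f N).
Proof.
  induction N as [|N IH]; cbn [psumZ]; [ring|rewrite IH; ring].
Qed.

Lemma psumZ_minus f g N :
  psumZ (fun n => Cminus (f n) (g n)) N = Cminus (psumZ f N) (psumZ g N).
Proof.
  induction N as [|N IH]; cbn [psumZ]; [ring|rewrite IH; ring].
Qed.

Lemma psumZ_swap (a : Z -> Z -> C) M N :
  psumZ (fun m => psumZ (a m) N) M = psumZ (fun n => psumZ (fun m => a m n) M) N.
Proof.
  induction M as [|M IH]; cbn [psumZ].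
  - induction N as [|N IHN]; cbn [psumZ]; [ring|rewrite <- IHN; ring].
  - rewrite IH. clear IH. induction N as [|N IHN]; cbn [psumZ]; [ring|].
    rewrite <- IHN. ring.
Qed.

Lemma sumZ_scal c f K r :
  0 <= r < 1 -> geom_dom f K r -> sumZ (fun n => Cmult c (f n)) = Cmult c (sumZ f).
Proof.
  intros Hr Hf. symmetry.
  apply sumZ_unique with (K := Cmod c * K) (r := r) (K' := Cmod c * (4 * (K / (1 - r)))).
  - exact Hr.
  - intro n. rewrite Cmod_mult, Rmult_assoc.
    apply Rmult_le_compat_l; [apply Cmod_ge_0|apply Hf].
  - intro N. rewrite psumZ_scal.
    replace (Cminus (Cmult c (sumZ f)) (Cmult c (psumZ f N)))
      with (Cmult c (Cminus (sumZ f) (psumZ f N))) by ring.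
    rewrite Cmod_mult, Rmult_assoc.
    apply Rmult_le_compat_l; [apply Cmod_ge_0|apply sumZ_tail; assumption].
Qed.

(** Reflection turns -N <= n < N into -N < n <= N: one endpoint is gained and the other lost. The
    shift by one in [psumZ_succ] moves the window in the same way. *)
Lemma psumZ_opp f N :
  psumZ (fun n => f (- n)%Z) N =
  Cplus (psumZ f N) (Cminus (f (Z.of_nat N)) (f (- Z.of_nat N)%Z)).
Proof.
  induction N as [|N IH]; cbn [psumZ]; [simpl; ring|].
  rewrite IH. rewrite Z.opp_involutive. ring.
Qed.

Lemma sumZ_opp f K r :
  0 <= r < 1 -> geom_dom f K r -> sumZ (fun n => f (- n)%Z) = sumZ f.
Proof.
  intros Hr Hf. pose proof (geom_dom_nonneg _ _ _ Hf) as HK. symmetry.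
  apply sumZ_unique with (K := K) (r := r) (K' := 4 * (K / (1 - r)) + 2 * K).
  - exact Hr.
  - intro n. replace (Z.abs_nat n) with (Z.abs_nat (- n)) by lia. apply Hf.
  - intro N. rewrite psumZ_opp.
    replace (Cminus (sumZ f) (Cplus (psumZ f N) (Cminus (f (Z.of_nat N)) (f (- Z.of_nat N)%Z))))
      with (Cplus (Cminus (sumZ f) (psumZ f N))
              (Cplus (Copp (f (Z.of_nat N))) (f (- Z.of_nat N)%Z))) by ring.
    eapply Rle_trans; [apply Cmod_triangle|].
    pose proof (Cmod_triangle (Copp (f (Z.of_nat N))) (f (- Z.of_nat N)%Z)) as H1.
    rewrite Cmod_opp in H1.
    pose proof (Hf (Z.of_nat N)) as H2. pose proof (Hf (- Z.of_nat N)%Z) as H3.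
    replace (Z.abs_nat (Z.of_nat N)) with N in H2 by lia.
    replace (Z.abs_nat (- Z.of_nat N)) with N in H3 by lia.
    pose proof (sumZ_tail f K r N Hr Hf). lra.
Qed.

Lemma psumZ_succ f N :
  psumZ (fun n => f (n + 1)%Z) N =
  Cplus (psumZ f N) (Cminus (f (Z.of_nat N)) (f (- Z.of_nat N)%Z)).
Proof.
  induction N as [|N IH]; cbn [psumZ]; [simpl; ring|].
  rewrite IH.
  replace (- Z.of_nat (S N) + 1)%Z with (- Z.of_nat N)%Z by lia.
  replace (Z.of_nat N + 1)%Z with (Z.of_nat (S N)) by lia. ring.
Qed.

(** Since |n + k| >= |n| - |k|, translation by k costs a factor r^(-|k|). *)
Lemma geom_dom_shift f K r k :
  0 < r < 1 -> geom_dom f K r ->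
  geom_dom (fun n => f (n + k)%Z) (K * / r ^ Z.abs_nat k) r.
Proof.
  intros Hr Hf n. pose proof (geom_dom_nonneg _ _ _ Hf) as HK.
  eapply Rle_trans; [apply Hf|]. rewrite Rmult_assoc.
  apply Rmult_le_compat_l; [exact HK|].
  assert (Hk : 0 < r ^ Z.abs_nat k) by (apply pow_lt; lra).
  apply Rmult_le_reg_l with (1 := Hk). rewrite <- Rmult_assoc, Rinv_r, Rmult_1_l by lra.
  rewrite <- pow_add. apply pow_geom_le; [lra|lia].
Qed.

Lemma sumZ_succ f K r :
  0 < r < 1 -> geom_dom f K r -> sumZ (fun n => f (n + 1)%Z) = sumZ f.
Proof.
  intros Hr Hf. pose proof (geom_dom_nonneg _ _ _ Hf) as HK. symmetry.
  apply sumZ_unique with (K := K * / r ^ Z.abs_nat 1) (r := r) (K' := 4 * (K / (1 - r)) + 2 * K).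
  - lra.
  - apply geom_dom_shift; assumption.
  - intro N. rewrite psumZ_succ.
    replace (Cminus (sumZ f) (Cplus (psumZ f N) (Cminus (f (Z.of_nat N)) (f (- Z.of_nat N)%Z))))
      with (Cplus (Cminus (sumZ f) (psumZ f N))
              (Cplus (Copp (f (Z.of_nat N))) (f (- Z.of_nat N)%Z))) by ring.
    eapply Rle_trans; [apply Cmod_triangle|].
    pose proof (Cmod_triangle (Copp (f (Z.of_nat N))) (f (- Z.of_nat N)%Z)) as H1.
    rewrite Cmod_opp in H1.
    pose proof (Hf (Z.of_nat N)) as H2. pose proof (Hf (- Z.of_nat N)%Z) as H3.
    replace (Z.abs_nat (Z.of_nat N)) with N in H2 by lia.
    replace (Z.abs_nat (- Z.of_nat N)) with N in H3 by lia.
    pose proof (sumZ_tail f K r N ltac:(lra) Hf). lra.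
Qed.

Lemma sumZ_shift_nat f K r (k : nat) :
  0 < r < 1 -> geom_dom f K r -> sumZ (fun n => f (n + Z.of_nat k)%Z) = sumZ f.
Proof.
  intros Hr Hf. induction k as [|k IH].
  - apply sumZ_ext. intro n. f_equal. lia.
  - rewrite <- IH.
    rewrite <- (sumZ_succ (fun n => f (n + Z.of_nat k)%Z) _ r Hr (geom_dom_shift f K r _ Hr Hf)).
    apply sumZ_ext. intro n. f_equal. lia.
Qed.

Lemma sumZ_shift f K r k :
  0 < r < 1 -> geom_dom f K r -> sumZ (fun n => f (n + k)%Z) = sumZ f.
Proof.
  intros Hr Hf. destruct (Z_le_gt_dec 0 k) as [Hk|Hk].
  - rewrite <- (sumZ_shift_nat f K r (Z.to_nat k) Hr Hf).
    apply sumZ_ext. intro n. f_equal. lia.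
  (* For negative k, the translate is shifted forward by -k, which restores f. *)
  - rewrite <- (sumZ_shift_nat _ _ r (Z.to_nat (- k)) Hr (geom_dom_shift f K r k Hr Hf)).
    apply sumZ_ext. intro n. f_equal. lia.
Qed.

(** The window -2N <= n < 2N splits exactly: both 2k and 2k + 1 lie in it precisely when -N <= k <
    N, so no boundary term appears. *)
Lemma psumZ_even_odd f N :
  psumZ f (2 * N) =
  Cplus (psumZ (fun k => f (2 * k)%Z) N) (psumZ (fun k => f (2 * k + 1)%Z) N).
Proof.
  induction N as [|N IH]; [simpl; ring|].
  replace (2 * S N)%nat with (S (S (2 * N))) by lia. cbn [psumZ].
  rewrite IH.
  replace (Z.of_nat (2 * N)) with (2 * Z.of_nat N)%Z by lia.
  replace (Z.of_nat (S (2 * N))) with (2 * Z.of_nat N + 1)%Z by lia.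
  replace (- Z.of_nat (S (S (2 * N))))%Z with (2 * - Z.of_nat (S N))%Z by lia.
  replace (- (2 * Z.of_nat N + 1))%Z with (2 * - Z.of_nat (S N) + 1)%Z by lia.
  ring.
Qed.

Lemma geom_dom_even f K r : 0 < r < 1 -> geom_dom f K r -> geom_dom (fun k => f (2 * k)%Z) K r.
Proof.
  intros Hr Hf n. eapply Rle_trans; [apply Hf|].
  apply Rmult_le_compat_l; [eapply geom_dom_nonneg; eassumption|].
  apply pow_geom_le; [lra|lia].
Qed.

Lemma geom_dom_odd f K r :
  0 < r < 1 -> geom_dom f K r ->
  geom_dom (fun k => f (2 * k + 1)%Z) (K * / r ^ Z.abs_nat 1) r.
Proof.
  intros Hr Hf. apply (geom_dom_even (fun n => f (n + 1)%Z)); [exact Hr|].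
  apply geom_dom_shift; assumption.
Qed.

Lemma sumZ_even_odd f K r :
  0 < r < 1 -> geom_dom f K r ->
  sumZ f = Cplus (sumZ (fun k => f (2 * k)%Z)) (sumZ (fun k => f (2 * k + 1)%Z)).
Proof.
  intros Hr Hf. pose proof (geom_dom_nonneg _ _ _ Hf) as HK.
  pose proof (geom_dom_even f K r Hr Hf) as He.
  pose proof (geom_dom_odd f K r Hr Hf) as Ho.
  set (K1 := K * / r ^ Z.abs_nat 1) in Ho.
  set (se := sumZ (fun k => f (2 * k)%Z)). set (so := sumZ (fun k => f (2 * k + 1)%Z)).
  assert (H0 : Cmod (Cminus (sumZ f) (Cplus se so)) = 0).
  { apply geom_le_eq0 with (r := r)
      (K := 4 * (K / (1 - r)) + (4 * (K / (1 - r)) + 4 * (K1 / (1 - r))));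
      [lra|apply Cmod_ge_0|].
    intro N.
    replace (Cminus (sumZ f) (Cplus se so)) with
      (Cplus (Cminus (sumZ f) (psumZ f (2 * N)))
        (Cplus (Copp (Cminus se (psumZ (fun k => f (2 * k)%Z) N)))
               (Copp (Cminus so (psumZ (fun k => f (2 * k + 1)%Z) N)))))
      by (rewrite psumZ_even_odd; ring).
    eapply Rle_trans; [apply Cmod_triangle|].
    match goal with |- _ + Cmod (Cplus ?a ?b) <= _ => pose proof (Cmod_triangle a b) as H1 end.
    rewrite !Cmod_opp in H1.
    pose proof (sumZ_tail f K r (2 * N) ltac:(lra) Hf) as H2.
    pose proof (sumZ_tail _ K r N ltac:(lra) He) as H3.
    pose proof (sumZ_tail _ K1 r N ltac:(lra) Ho) as H4.
    fold se in H3. fold so in H4.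
    assert (H5 : r ^ (2 * N) <= r ^ N) by (apply pow_geom_le; [lra|lia]).
    assert (H6 : 0 <= 4 * (K / (1 - r))).
    { assert (0 <= K / (1 - r)) by (apply Rdiv_le_0_compat; lra). lra. }
    assert (4 * (K / (1 - r)) * r ^ (2 * N) <= 4 * (K / (1 - r)) * r ^ N)
      by (apply Rmult_le_compat_l; assumption).
    lra. }
  apply Cmod_eq_0 in H0.
  replace (sumZ f) with (Cplus (Cminus (sumZ f) (Cplus se so)) (Cplus se so)) by ring.
  rewrite H0. ring.
Qed.

(** * Double sums and the product of two series *)

Lemma psumZ_geom_bound f K r N :
  0 <= r < 1 -> geom_dom f K r -> Cmod (psumZ f N) <= 2 * K / (1 - r).
Proof.
  intros Hr Hf. pose proof (geom_dom_nonneg _ _ _ Hf) as HK.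
  (* The factor 1 - r^N strengthens the bound so that the induction telescopes. *)
  apply Rle_trans with (2 * K / (1 - r) * (1 - r ^ N)).
  - induction N as [|N IH]; cbn [psumZ].
    + rewrite Cmod_0. simpl. lra.
    + eapply Rle_trans; [apply Cmod_triangle|].
      pose proof (Cmod_triangle (f (Z.of_nat N)) (f (- Z.of_nat (S N))%Z)) as H1.
      pose proof (Hf (Z.of_nat N)) as H2. pose proof (Hf (- Z.of_nat (S N))%Z) as H3.
      replace (Z.abs_nat (Z.of_nat N)) with N in H2 by lia.
      replace (Z.abs_nat (- Z.of_nat (S N))) with (S N) in H3 by lia.
      assert (H4 : r ^ S N <= r ^ N) by (apply pow_geom_le; [lra|lia]).
      assert (H5 : K * r ^ S N <= K * r ^ N) by (apply Rmult_le_compat_l; lra).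
      replace (2 * K / (1 - r) * (1 - r ^ S N))
        with (2 * K / (1 - r) * (1 - r ^ N) + 2 * (K * r ^ N)) by (simpl; field; lra).
      lra.
  - assert (0 <= r ^ N) by (apply pow_le; lra).
    assert (0 <= 2 * K / (1 - r)) by (apply Rdiv_le_0_compat; lra). nra.
Qed.

Lemma sumZ_geom_bound f K r :
  0 <= r < 1 -> geom_dom f K r -> Cmod (sumZ f) <= 4 * (K / (1 - r)).
Proof.
  intros Hr Hf. pose proof (sumZ_tail f K r 0 Hr Hf) as H. cbn [psumZ] in H.
  replace (Cminus (sumZ f) (RtoC 0)) with (sumZ f) in H by ring.
  simpl in H. lra.
Qed.

(** The error over the square window has two sources: the rows outside it, and the tails of the rows
    inside. The tail of row m is O(r^N r^|m|), which is still summable over m. *)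
Lemma iterated_sumZ_tail (a : Z -> Z -> C) K r :
  0 <= r < 1 ->
  (forall m n, Cmod (a m n) <= K * r ^ Z.abs_nat m * r ^ Z.abs_nat n) ->
  exists K', forall N,
    Cmod (Cminus (sumZ (fun m => sumZ (a m))) (psumZ (fun m => psumZ (a m) N) N)) <= K' * r ^ N.
Proof.
  intros Hr Ha.
  assert (HK : 0 <= K).
  { specialize (Ha 0%Z 0%Z). simpl in Ha. pose proof (Cmod_ge_0 (a 0%Z 0%Z)). lra. }
  set (L := 4 * (K / (1 - r))).
  assert (HL : 0 <= L).
  { assert (0 <= K / (1 - r)) by (apply Rdiv_le_0_compat; lra). unfold L. lra. }
  assert (Hm : forall m, geom_dom (a m) (K * r ^ Z.abs_nat m) r) by (intros m n; apply Ha).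
  assert (Hs : geom_dom (fun m => sumZ (a m)) L r).
  { intro m. eapply Rle_trans; [apply (sumZ_geom_bound _ _ r Hr (Hm m))|].
    unfold L. apply Req_le. field. lra. }
  exists (4 * (L / (1 - r)) + 2 * L / (1 - r)). intro N.
  replace (Cminus (sumZ (fun m => sumZ (a m))) (psumZ (fun m => psumZ (a m) N) N)) with
    (Cplus (Cminus (sumZ (fun m => sumZ (a m))) (psumZ (fun m => sumZ (a m)) N))
       (psumZ (fun m => Cminus (sumZ (a m)) (psumZ (a m) N)) N))
    by (rewrite psumZ_minus; ring).
  eapply Rle_trans; [apply Cmod_triangle|].
  pose proof (sumZ_tail _ L r N Hr Hs) as H1.
  assert (H2 : geom_dom (fun m => Cminus (sumZ (a m)) (psumZ (a m) N)) (L * r ^ N) r).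
  { intro m. eapply Rle_trans; [apply (sumZ_tail _ _ r N Hr (Hm m))|].
    unfold L. apply Req_le. field. lra. }
  pose proof (psumZ_geom_bound _ _ r N Hr H2) as H3.
  replace (2 * (L * r ^ N) / (1 - r)) with (2 * L / (1 - r) * r ^ N) in H3 by (field; lra).
  lra.
Qed.

(** Both iterated sums are approximated by the same square window, on which the finite sums
    commute. *)
Lemma sumZ_swap (a : Z -> Z -> C) K r :
  0 <= r < 1 ->
  (forall m n, Cmod (a m n) <= K * r ^ Z.abs_nat m * r ^ Z.abs_nat n) ->
  sumZ (fun m => sumZ (a m)) = sumZ (fun n => sumZ (fun m => a m n)).
Proof.
  intros Hr Ha.
  destruct (iterated_sumZ_tail a K r Hr Ha) as [K1 H1].
  destruct (iterated_sumZ_tail (fun n m => a m n) K r Hr) as [K2 H2].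
  { intros m n. specialize (Ha n m). lra. }
  set (s1 := sumZ (fun m => sumZ (a m))) in *.
  set (s2 := sumZ (fun n => sumZ (fun m => a m n))) in *.
  assert (H0 : Cmod (Cminus s1 s2) = 0).
  { apply geom_le_eq0 with (r := r) (K := K1 + K2); [exact Hr|apply Cmod_ge_0|].
    intro N. specialize (H1 N). specialize (H2 N). cbn beta in H2.
    rewrite (psumZ_swap (fun n m => a m n)) in H2. cbn beta in H2.
    replace (Cminus s1 s2) with
      (Cplus (Cminus s1 (psumZ (fun m => psumZ (a m) N) N))
             (Copp (Cminus s2 (psumZ (fun m => psumZ (a m) N) N)))) by ring.
    eapply Rle_trans; [apply Cmod_triangle|]. rewrite Cmod_opp.
    change (fun m => psumZ (fun n => a m n) N) with (fun m => psumZ (a m) N) in H2. lra. }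
  apply Cmod_eq_0 in H0.
  replace s1 with (Cplus (Cminus s1 s2) s2) by ring. rewrite H0. ring.
Qed.

(* Substitute m = n + t, then split according to the parity of t:
   the new indices are j = (m + n) / 2 and k = (m - n) / 2, rounded. *)
Lemma sumZ_mul_diag f g F0 G0 F1 G1 r Kf Kg K0 L0 K1 L1 :
  0 < r < 1 ->
  geom_dom f Kf r -> geom_dom g Kg r ->
  geom_dom F0 K0 r -> geom_dom G0 L0 r -> geom_dom F1 K1 r -> geom_dom G1 L1 r ->
  (forall j k, Cmult (f (j + k)%Z) (g (j - k)%Z) = Cmult (F0 j) (G0 k)) ->
  (forall j k, Cmult (f (j + k + 1)%Z) (g (j - k)%Z) = Cmult (F1 j) (G1 k)) ->
  Cmult (sumZ f) (sumZ g) =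
  Cplus (Cmult (sumZ F0) (sumZ G0)) (Cmult (sumZ F1) (sumZ G1)).
Proof.
  intros Hr Hf Hg HF0 HG0 HF1 HG1 E0 E1.
  pose proof (geom_dom_nonneg _ _ _ Hf) as HKf.
  pose proof (geom_dom_nonneg _ _ _ Hg) as HKg.
  assert (Hr' : 0 <= r < 1) by lra.
  set (a := fun m t => Cmult (f m) (g (m - t)%Z)).
  (* Domination in m and t separately is paid for by a larger ratio: with r = q^2 the exponent is
     2|m| + 2|m - t|, which is at least |m| + |t|. *)
  set (q := sqrt r).
  assert (Hq : 0 < q < 1).
  { unfold q. split; [apply sqrt_lt_R0; lra|].
    rewrite <- sqrt_1. apply sqrt_lt_1; lra. }
  assert (Hqr : r = q ^ 2) by (unfold q; rewrite pow2_sqrt; lra).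
  assert (Ha : forall m t, Cmod (a m t) <= (Kf * Kg) * q ^ Z.abs_nat m * q ^ Z.abs_nat t).
  { intros m t. unfold a. rewrite Cmod_mult.
    eapply Rle_trans.
    { apply Rmult_le_compat; [apply Cmod_ge_0|apply Cmod_ge_0|apply Hf|apply Hg]. }
    replace (Kf * r ^ Z.abs_nat m * (Kg * r ^ Z.abs_nat (m - t)))
      with (Kf * Kg * (r ^ Z.abs_nat m * r ^ Z.abs_nat (m - t))) by ring.
    rewrite (Rmult_assoc (Kf * Kg)).
    apply Rmult_le_compat_l; [apply Rmult_le_pos; assumption|].
    rewrite Hqr, <- !pow_mult, <- !pow_add.
    apply pow_geom_le; [lra|lia]. }
  assert (Hsw : Cmult (sumZ f) (sumZ g) = sumZ (fun m => sumZ (a m))).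
  { rewrite Cmult_comm, <- (sumZ_scal _ f Kf r Hr' Hf).
    apply sumZ_ext. intro m. unfold a.
    rewrite (sumZ_scal (f m) (fun t => g (m - t)%Z) (Kg * / r ^ Z.abs_nat m) r Hr').
    - rewrite Cmult_comm. f_equal.
      rewrite <- (sumZ_shift g Kg r m Hr Hg).
      rewrite <- (sumZ_opp _ _ r Hr' (geom_dom_shift g Kg r m Hr Hg)).
      apply sumZ_ext. intro n. f_equal. lia.
    - intro t. pose proof (geom_dom_shift g Kg r m Hr Hg (- t)%Z) as H.
      cbn beta in H. replace (- t + m)%Z with (m - t)%Z in H by lia.
      replace (Z.abs_nat (- t)) with (Z.abs_nat t) in H by lia. exact H. }
  rewrite Hsw, (sumZ_swap a (Kf * Kg) q ltac:(lra) Ha).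
  assert (Hd : forall t, geom_dom (fun m => a m t) (Kf * Kg * / r ^ Z.abs_nat t) r).
  { intros t m. unfold a. rewrite Cmod_mult.
    replace (Kf * Kg * / r ^ Z.abs_nat t * r ^ Z.abs_nat m)
      with ((Kf * r ^ Z.abs_nat m) * (Kg * / r ^ Z.abs_nat t)) by ring.
    apply Rmult_le_compat; [apply Cmod_ge_0|apply Cmod_ge_0|apply Hf|].
    pose proof (geom_dom_shift g Kg r (- t)%Z Hr Hg m) as H. cbn beta in H.
    replace (Z.abs_nat (- t)) with (Z.abs_nat t) in H by lia.
    eapply Rle_trans; [exact H|].
    rewrite <- (Rmult_1_r (Kg * / r ^ Z.abs_nat t)) at 2.
    apply Rmult_le_compat_l.
    - apply Rmult_le_pos; [exact HKg|].
      left. apply Rinv_0_lt_compat, pow_lt; lra.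
    - rewrite <- (pow_O r). apply pow_geom_le; [lra|lia]. }
  assert (Hs : geom_dom (fun t => sumZ (fun m => a m t)) (4 * (Kf * Kg / (1 - q))) q).
  { intro t.
    eapply Rle_trans; [apply (sumZ_geom_bound _ (Kf * Kg * q ^ Z.abs_nat t) q)|].
    - lra.
    - intro m. eapply Rle_trans; [apply Ha|]. lra.
    - apply Req_le. field. lra. }
  rewrite (sumZ_even_odd _ _ q Hq Hs).
  f_equal.
  (* For t = 2k put m = j + k, so that m - t = j - k. *)
  - rewrite <- (sumZ_scal _ G0 L0 r Hr' HG0). apply sumZ_ext. intro k.
    rewrite <- (sumZ_shift _ _ r k Hr (Hd (2 * k)%Z)).
    rewrite Cmult_comm, <- (sumZ_scal _ F0 K0 r Hr' HF0).
    apply sumZ_ext. intro j. unfold a.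
    rewrite (Cmult_comm (G0 k)), <- E0. do 2 f_equal. lia.
  (* For t = 2k + 1 put m = j + k + 1, so that again m - t = j - k. *)
  - rewrite <- (sumZ_scal _ G1 L1 r Hr' HG1). apply sumZ_ext. intro k.
    rewrite <- (sumZ_shift _ _ r (k + 1)%Z Hr (Hd (2 * k + 1)%Z)).
    rewrite Cmult_comm, <- (sumZ_scal _ F1 K1 r Hr' HF1).
    apply sumZ_ext. intro j. unfold a.
    rewrite (Cmult_comm (G1 k)), <- E1. f_equal; f_equal; lia.
Qed.

(** * The complex exponential and phases, with angles measured in full turns *)

Lemma cexp_plus z w : cexp (Cplus z w) = Cmult (cexp z) (cexp w).
Proof.
  unfold cexp, Cmult, Cplus, Re, Im; cbn [fst snd].
  rewrite exp_plus, cos_plus, sin_plus. f_equal; ring.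
Qed.

Lemma Cmod_cexp z : Cmod (cexp z) = exp (Re z).
Proof.
  unfold Cmod, cexp; cbn [fst snd].
  replace ((exp (Re z) * cos (Im z)) ^ 2 + (exp (Re z) * sin (Im z)) ^ 2)
    with (Rsqr (exp (Re z)) * (Rsqr (sin (Im z)) + Rsqr (cos (Im z)))) by (unfold Rsqr; ring).
  rewrite sin2_cos2, Rmult_1_r. apply sqrt_Rsqr. left. apply exp_pos.
Qed.

Definition phase (t : R) : C := cexp (0, 2 * PI * t).

Lemma phase_plus s t : phase (s + t) = Cmult (phase s) (phase t).
Proof.
  unfold phase. rewrite <- cexp_plus. f_equal. unfold Cplus; cbn [fst snd]. f_equal; ring.
Qed.

Lemma phase_0 : phase 0 = RtoC 1.
Proof.
  unfold phase, cexp, Re, Im; cbn [fst snd].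
  rewrite !Rmult_0_r, exp_0, cos_0, sin_0. unfold RtoC. f_equal; ring.
Qed.

Lemma phase_half : phase (1 / 2) = RtoC (-1).
Proof.
  unfold phase, cexp, Re, Im; cbn [fst snd].
  replace (2 * PI * (1 / 2)) with PI by field.
  rewrite exp_0, cos_PI, sin_PI. unfold RtoC. f_equal; ring.
Qed.

Lemma phase_1 : phase 1 = RtoC 1.
Proof.
  replace 1 with (1 / 2 + 1 / 2) at 1 by field. rewrite phase_plus, phase_half.
  rewrite <- RtoC_mult. f_equal. ring.
Qed.

Lemma phase_opp t : Cmult (phase (- t)) (phase t) = RtoC 1.
Proof.
  rewrite <- phase_plus. replace (- t + t) with 0 by ring. apply phase_0.
Qed.

Lemma phase_nat (n : nat) : phase (INR n) = RtoC 1.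
Proof.
  induction n as [|n IH]; [apply phase_0|].
  rewrite S_INR, phase_plus, IH, phase_1. ring.
Qed.

Lemma phase_Z (n : Z) : phase (IZR n) = RtoC 1.
Proof.
  destruct (Z_le_gt_dec 0 n) as [H|H].
  - rewrite <- (Z2Nat.id n H), <- INR_IZR_INZ. apply phase_nat.
  - pose proof (phase_opp (IZR n)) as E. rewrite <- opp_IZR in E.
    rewrite <- (Z2Nat.id (- n)) in E by lia. rewrite <- INR_IZR_INZ, phase_nat in E.
    rewrite <- E. ring.
Qed.

(** * Theta constants with halved characteristics: convergence and periods *)

Definition gterm (a b : R) (tau : C) (n : Z) : C :=
  cexp (- (PI * Im tau * (IZR n + a) ^ 2),
        PI * Re tau * (IZR n + a) ^ 2 + 2 * PI * (IZR n + a) * b).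

Definition Theta (a b : R) (tau : C) : C := sumZ (gterm a b tau).

Lemma thetac_Theta eps eps' tau : thetac eps eps' tau = Theta (eps / 2) (eps' / 2) tau.
Proof.
  unfold thetac, theta, Theta. apply sumZ_ext. intro n. unfold theta_term, gterm.
  f_equal. destruct tau as [u v]. unfold Cmult, Cplus, RtoC, Ci, Re, Im; cbn [fst snd].
  f_equal; field.
Qed.

Lemma exp_opp_nat x (n : nat) : exp (- (x * INR n)) = exp (- x) ^ n.
Proof.
  induction n as [|n IH].
  - simpl. rewrite Rmult_0_r, Ropp_0. apply exp_0.
  - rewrite S_INR. simpl. rewrite <- IH, <- exp_plus. f_equal. ring.
Qed.

Lemma INR_abs_nat n : INR (Z.abs_nat n) = Rabs (IZR n).
Proof.
  rewrite INR_IZR_INZ, Nat2Z.inj_abs_nat. apply abs_IZR.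
Qed.

(** The modulus of the term is exp(-pi Im(tau) (n + a)^2), so any linear minorant c|n| - d of the
    quadratic gives a geometric majorant. It is used with a crude minorant for convergence and a
    sharp one for non-vanishing. *)
Lemma gterm_dom_of_quadratic a b tau c d :
  0 < Im tau ->
  (forall n, c * Rabs (IZR n) - d <= (IZR n + a) ^ 2) ->
  geom_dom (gterm a b tau) (exp (PI * Im tau * d)) (exp (- (PI * Im tau * c))).
Proof.
  intros Ht H n. unfold gterm. rewrite Cmod_cexp. unfold Re at 1; cbn [fst].
  rewrite <- exp_opp_nat, <- exp_plus, INR_abs_nat.
  specialize (H n). pose proof PI_RGT_0 as Hp.
  assert (Hpt : 0 < PI * Im tau) by (apply Rmult_lt_0_compat; lra).
  assert (H1 : PI * Im tau * (c * Rabs (IZR n) - d) <= PI * Im tau * (IZR n + a) ^ 2)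
    by (apply Rmult_le_compat_l; lra).
  destruct (Rle_lt_or_eq_dec _ _ H1) as [H2|H2].
  - left. apply exp_increasing. lra.
  - right. f_equal. lra.
Qed.

Lemma gterm_dom a b tau :
  0 < Im tau ->
  geom_dom (gterm a b tau) (exp (PI * Im tau * (Rabs a + / 4))) (exp (- (PI * Im tau * 1))).
Proof.
  intro Ht. apply gterm_dom_of_quadratic; [exact Ht|]. intro n.
  set (x := IZR n).
  assert (H : - (Rabs x * Rabs a) <= x * a).
  { rewrite <- Rabs_mult. pose proof (Rle_abs (- (x * a))) as H0. rewrite Rabs_Ropp in H0. lra. }
  pose proof (pow2_abs x) as Hx. pose proof (pow2_abs a) as Ha.
  (* Expanding this square gives (|x| - |a|)^2 >= |x| - |a| - 1/4, the source of the constant |a| +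
     1/4. *)
  pose proof (pow2_ge_0 (Rabs x - (Rabs a + / 2))) as Hs.
  replace ((x + a) ^ 2) with (x ^ 2 + 2 * (x * a) + a ^ 2) by ring.
  rewrite <- Hx, <- Ha. nra.
Qed.

Lemma nome_bounds x : 0 < x -> 0 < exp (- x) < 1.
Proof.
  intro H. split; [apply exp_pos|]. rewrite <- exp_0. apply exp_increasing. lra.
Qed.

Lemma gterm_nome_bounds tau : 0 < Im tau -> 0 < exp (- (PI * Im tau * 1)) < 1.
Proof.
  intro H. apply nome_bounds. rewrite Rmult_1_r.
  apply Rmult_lt_0_compat; [apply PI_RGT_0|exact H].
Qed.

Lemma Theta_shift_a a b tau : 0 < Im tau -> Theta (a + 1) b tau = Theta a b tau.
Proof.
  intro Ht. unfold Theta.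
  rewrite <- (sumZ_succ _ _ _ (gterm_nome_bounds tau Ht) (gterm_dom a b tau Ht)).
  apply sumZ_ext. intro n. unfold gterm. rewrite plus_IZR.
  replace (IZR n + (a + 1)) with (IZR n + 1 + a) by ring. reflexivity.
Qed.

Lemma Theta_shift_b a b tau : 0 < Im tau -> Theta a (b + 1) tau = Cmult (phase a) (Theta a b tau).
Proof.
  intro Ht. pose proof (gterm_nome_bounds tau Ht) as Hr. unfold Theta.
  rewrite <- (sumZ_scal _ _ _ (exp (- (PI * Im tau * 1))) ltac:(lra) (gterm_dom a b tau Ht)).
  apply sumZ_ext. intro n.
  replace (phase a) with (phase (IZR n + a)) by (rewrite phase_plus, phase_Z; ring).
  unfold gterm, phase. rewrite <- cexp_plus. f_equal.
  unfold Cplus; cbn [fst snd]. f_equal; ring.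
Qed.

Lemma Theta_opp a b tau : 0 < Im tau -> Theta (- a) (- b) tau = Theta a b tau.
Proof.
  intro Ht. pose proof (gterm_nome_bounds tau Ht) as Hr. unfold Theta.
  rewrite <- (sumZ_opp _ _ (exp (- (PI * Im tau * 1))) ltac:(lra) (gterm_dom a b tau Ht)).
  apply sumZ_ext. intro n. unfold gterm. f_equal. rewrite opp_IZR. f_equal; ring.
Qed.

(** * The product formula at 2 tau *)

Definition dbl (tau : C) : C := (2 * Re tau, 2 * Im tau).

Lemma Im_dbl_pos tau : 0 < Im tau -> 0 < Im (dbl tau).
Proof.
  intro H. unfold dbl, Im at 1; cbn [snd]. lra.
Qed.

(** Brings the series at tau and at 2 tau to one common ratio, as [sumZ_mul_diag] requires. *)
Lemma geom_dom_weaken f K r q : 0 <= r <= q -> geom_dom f K r -> geom_dom f K q.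
Proof.
  intros Hr Hf n. eapply Rle_trans; [apply Hf|].
  apply Rmult_le_compat_l; [eapply geom_dom_nonneg; eassumption|].
  apply pow_incr. exact Hr.
Qed.

(** The parallelogram identity (j+k+a)^2 + (j-k+a')^2 = 2 (j + (a+a')/2)^2 + 2 (k + (a-a')/2)^2
    separates the variables, and the terms linear in b, b' separate with no leftover phase. Index
    pairs of opposite parity give the second product, with both halves shifted by 1/2. *)
Lemma Theta_mul a b a' b' tau :
  0 < Im tau ->
  Cmult (Theta a b tau) (Theta a' b' tau) =
  Cplus (Cmult (Theta ((a + a') / 2) (b + b') (dbl tau)) (Theta ((a - a') / 2) (b - b') (dbl tau)))
        (Cmult (Theta ((a + a') / 2 + 1 / 2) (b + b') (dbl tau))
               (Theta ((a - a') / 2 + 1 / 2) (b - b') (dbl tau))).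
Proof.
  intro Ht. pose proof (gterm_nome_bounds tau Ht) as Hr.
  pose proof (Im_dbl_pos tau Ht) as Ht2.
  assert (Hw : 0 <= exp (- (PI * Im (dbl tau) * 1)) <= exp (- (PI * Im tau * 1))).
  { split; [left; apply exp_pos|]. left. apply exp_increasing.
    change (Im (dbl tau)) with (2 * Im tau). pose proof PI_RGT_0.
    assert (0 < PI * Im tau) by (apply Rmult_lt_0_compat; lra). lra. }
  unfold Theta.
  eapply sumZ_mul_diag with (r := exp (- (PI * Im tau * 1))).
  - exact Hr.
  - apply gterm_dom; exact Ht.
  - apply gterm_dom; exact Ht.
  - apply (geom_dom_weaken _ _ _ _ Hw), gterm_dom; exact Ht2.
  - apply (geom_dom_weaken _ _ _ _ Hw), gterm_dom; exact Ht2.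
  - apply (geom_dom_weaken _ _ _ _ Hw), gterm_dom; exact Ht2.
  - apply (geom_dom_weaken _ _ _ _ Hw), gterm_dom; exact Ht2.
  - intros j k. unfold gterm. rewrite <- !cexp_plus. f_equal.
    rewrite minus_IZR, plus_IZR.
    unfold dbl, Cplus, Re, Im; cbn [fst snd]. f_equal; field.
  - intros j k. unfold gterm. rewrite <- !cexp_plus. f_equal.
    rewrite minus_IZR, !plus_IZR.
    unfold dbl, Cplus, Re, Im; cbn [fst snd]. f_equal; field.
Qed.

(** * The odd theta function and the three-term identity *)

Definition Theta1 (a b : R) (tau : C) : C := Theta (a + 1 / 2) (b + 1 / 2) tau.

(** The 2x2 minor f x * g x' - g x * f x', where f x = [Theta a (2 * b) tau] and g x =
    [Theta (a + 1 / 2) (2 * b) tau]. *)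
Definition Theta_minor (a b a' b' : R) (tau : C) : C :=
  Cminus (Cmult (Theta a (2 * b) tau) (Theta (a' + 1 / 2) (2 * b') tau))
         (Cmult (Theta (a + 1 / 2) (2 * b) tau) (Theta a' (2 * b') tau)).

(** The sum index acquires second characteristic 2b + 1. Removing the period 1 costs [phase a] in
    one product and [phase (a + 1 / 2)] in the other; these differ by the sign [phase (1 / 2)] = -1,
    which turns the sum into a determinant. *)
Lemma Theta1_mul a b a' b' tau :
  0 < Im tau ->
  Cmult (Theta1 (a + a') (b + b') tau) (Theta1 (a - a') (b - b') tau) =
  Cmult (phase a) (Theta_minor a b a' b' (dbl tau)).
Proof.
  intro Ht. pose proof (Im_dbl_pos tau Ht) as Ht2. unfold Theta1, Theta_minor.
  rewrite Theta_mul by exact Ht.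
  replace ((a + a' + 1 / 2 + (a - a' + 1 / 2)) / 2) with (a + 1 / 2) by field.
  replace (b + b' + 1 / 2 + (b - b' + 1 / 2)) with (2 * b + 1) by field.
  replace ((a + a' + 1 / 2 - (a - a' + 1 / 2)) / 2) with a' by field.
  replace (b + b' + 1 / 2 - (b - b' + 1 / 2)) with (2 * b') by field.
  replace (a + 1 / 2 + 1 / 2) with (a + 1) by field.
  rewrite Theta_shift_a, !Theta_shift_b by exact Ht2.
  rewrite phase_plus, phase_half.
  change (RtoC (-1)) with (RtoC (- (1))). rewrite RtoC_opp. ring.
Qed.

Lemma Theta1_opp a b tau :
  0 < Im tau -> Theta1 (- a) (- b) tau = Copp (Cmult (phase (- a)) (Theta1 a b tau)).
Proof.
  intro Ht. unfold Theta1. rewrite <- Theta_opp by exact Ht.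
  rewrite <- Theta_shift_a by exact Ht.
  replace (- (- a + 1 / 2) + 1) with (a + 1 / 2) by field.
  replace (b + 1 / 2) with (- (- b + 1 / 2) + 1) by field.
  rewrite Theta_shift_b by exact Ht.
  rewrite phase_plus, phase_half.
  change (RtoC (-1)) with (RtoC (- (1))). rewrite RtoC_opp.
  transitivity (Cmult (Cmult (phase (- a)) (phase a)) (Theta (a + 1 / 2) (- (- b + 1 / 2)) tau));
    [rewrite phase_opp|]; ring.
Qed.

(** With x = (a, b) and y = (a', b'), the four points x + y, 0, x, y are paired in three ways. Each
    pairing gives two values of [Theta1_mul], and the repeated arguments, made equal by oddness,
    combine into a cube. *)
Lemma three_term_cube a b a' b' tau :
  0 < Im tau ->
  Cplus (Cmult (phase (- a)) (Cmult (cube (Theta1 (a + a') (b + b') tau)) (Theta1 (a - a') (b - b') tau)))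
        (Cmult (phase (- a')) (Cmult (Theta1 (2 * a + a') (2 * b + b') tau) (cube (Theta1 a' b' tau)))) =
  Cmult (phase (- a)) (Cmult (Theta1 (a + 2 * a') (b + 2 * b') tau) (cube (Theta1 a b tau))).
Proof.
  intro Ht.
  pose proof (Theta1_mul (a + a') (b + b') 0 0 tau Ht) as E1.
  pose proof (Theta1_mul a b a' b' tau Ht) as E2.
  pose proof (Theta1_mul (a + a') (b + b') a b tau Ht) as E3.
  pose proof (Theta1_mul 0 0 a' b' tau Ht) as E4.
  pose proof (Theta1_mul (a + a') (b + b') a' b' tau Ht) as E5.
  pose proof (Theta1_mul 0 0 a b tau Ht) as E6.
  rewrite !Rplus_0_r, !Rminus_0_r in E1.
  rewrite !Rplus_0_l, !Rminus_0_l, Theta1_opp, phase_0 in E4, E6 by exact Ht.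
  replace (a + a' + a) with (2 * a + a') in E3 by ring.
  replace (b + b' + b) with (2 * b + b') in E3 by ring.
  replace (a + a' - a) with a' in E3 by ring.
  replace (b + b' - b) with b' in E3 by ring.
  replace (a + a' + a') with (a + 2 * a') in E5 by ring.
  replace (b + b' + b') with (b + 2 * b') in E5 by ring.
  replace (a + a' - a') with a in E5 by ring.
  replace (b + b' - b') with b in E5 by ring.
  pose proof (phase_opp a) as P.
  set (A := Theta_minor _ _ _ _ _) in E1. set (B := Theta_minor _ _ _ _ _) in E2.
  set (A3 := Theta_minor _ _ _ _ _) in E3. set (B4 := Theta_minor _ _ _ _ _) in E4.
  set (A5 := Theta_minor _ _ _ _ _) in E5. set (B6 := Theta_minor _ _ _ _ _) in E6.
  (* The Pluecker relation p12 p34 - p13 p24 + p14 p23 = 0 for the points in the order x + y, 0, x,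
     y. *)
  assert (PL : Cplus (Cminus (Cmult A B) (Cmult A3 B4)) (Cmult A5 B6) = RtoC 0)
    by (unfold A, B, A3, B4, A5, B6, Theta_minor; ring).
  clearbody A B A3 B4 A5 B6. unfold cube.
  set (p := phase (a + a')) in *. set (Hs := Theta1 (a + a') (b + b') tau) in *.
  set (Hm := Theta1 (a - a') (b - b') tau) in *. set (Ha := Theta1 a b tau) in *.
  set (Hb := Theta1 a' b' tau) in *. set (H3 := Theta1 (2 * a + a') _ tau) in *.
  set (H5 := Theta1 (a + 2 * a') _ tau) in *.
  set (pa := phase a) in *. set (na := phase (- a)) in *. set (nb := phase (- a')) in *.
  transitivity (Cplus (Cmult na (Cmult (Cmult Hs Hs) (Cmult Hs Hm)))
                      (Copp (Cmult (Cmult H3 Hb) (Cmult Hb (Copp (Cmult nb Hb)))))); [ring|].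
  transitivity (Copp (Cmult (Cmult H5 Ha) (Cmult Ha (Copp (Cmult na Ha))))); [|ring].
  rewrite E1, E2, E3, E4, E5, E6.
  transitivity (Cplus (Cmult (Cmult na pa) (Cmult p (Cmult A B))) (Copp (Cmult p (Cmult A3 B4))));
    [ring|]. rewrite P.
  transitivity (Cplus (Cmult p (Cplus (Cminus (Cmult A B) (Cmult A3 B4)) (Cmult A5 B6)))
                      (Copp (Cmult p (Cmult A5 B6)))); [ring|].
  rewrite PL. ring.
Qed.

(** * Non-vanishing of the theta constants *)

Lemma eq_Copp_0 z : z = Copp z -> z = RtoC 0.
Proof.
  destruct z as [x y]. unfold Copp, RtoC; cbn [fst snd]. intro E.
  injection E as E1 E2. f_equal; lra.
Qed.

(** The second product of [Theta_mul] contains [Theta (1 / 2) (- (1 / 2))], which reflection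
    followed by unit shifts makes equal to its own negative. *)
Lemma Theta_dbl a b tau :
  0 < Im tau ->
  Cmult (Theta a b tau) (Theta a (b + 1 / 2) tau) =
  Cmult (Theta a (2 * b + 1 / 2) (dbl tau)) (Theta 0 (1 / 2) (dbl tau)).
Proof.
  intro Ht. pose proof (Im_dbl_pos tau Ht) as Ht2. rewrite Theta_mul by exact Ht.
  replace ((a + a) / 2) with a by field. replace ((a - a) / 2) with 0 by field.
  replace (b + (b + 1 / 2)) with (2 * b + 1 / 2) by ring.
  replace (b - (b + 1 / 2)) with (- (1 / 2)) by ring.
  rewrite Rplus_0_l.
  assert (Ev : Theta 0 (- (1 / 2)) (dbl tau) = Theta 0 (1 / 2) (dbl tau)).
  { rewrite <- Theta_opp by exact Ht2. rewrite Ropp_involutive, Ropp_0. reflexivity. }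
  assert (Z0 : Theta (1 / 2) (- (1 / 2)) (dbl tau) = RtoC 0).
  { assert (E : Theta (1 / 2) (- (1 / 2)) (dbl tau) = Copp (Theta (1 / 2) (- (1 / 2)) (dbl tau))).
    { rewrite <- Theta_opp at 1 by exact Ht2. rewrite Ropp_involutive.
      rewrite <- Theta_shift_a by exact Ht2.
      replace (- (1 / 2) + 1) with (1 / 2) by field.
      replace (1 / 2) with (- (1 / 2) + 1) at 2 by field.
      rewrite Theta_shift_b, phase_half by exact Ht2.
      change (RtoC (-1)) with (RtoC (- (1))). rewrite RtoC_opp. ring. }
    exact (eq_Copp_0 _ E). }
  rewrite Ev, Z0. ring.
Qed.

(** For |a| < 1/2 the term n = 0 strictly dominates. Relative to it, the term n = -1 is at most 1/10
    and all the others together at most 1/2. *)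
Lemma Theta_neq0_large_Im a b tau :
  Rabs a < 1 / 2 -> 0 < Im tau ->
  exp (- (PI * Im tau * (1 - 2 * Rabs a))) <= 1 / 10 -> Theta a b tau <> RtoC 0.
Proof.
  intros Ha Ht Hr E. set (r := exp (- (PI * Im tau * (1 - 2 * Rabs a)))) in *.
  assert (Hr0 : 0 < r) by apply exp_pos.
  set (K := exp (PI * Im tau * - a ^ 2)).
  assert (HK : 0 < K) by apply exp_pos.
  assert (Hd : geom_dom (gterm a b tau) K r).
  { apply gterm_dom_of_quadratic; [exact Ht|]. intro n.
    destruct (Z.eq_dec n 0) as [->|Hn]; [rewrite Rabs_R0; right; ring|].
    assert (H1 : 1 <= Rabs (IZR n)) by (rewrite <- abs_IZR; apply IZR_le; lia).
    set (x := IZR n) in *.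
    assert (H2 : - (Rabs x * Rabs a) <= x * a).
    { rewrite <- Rabs_mult. pose proof (Rle_abs (- (x * a))) as H0.
      rewrite Rabs_Ropp in H0. lra. }
    replace ((x + a) ^ 2) with (x ^ 2 + 2 * (x * a) + a ^ 2) by ring.
    (* Because |x| >= 1, one has |x|^2 - 2|x||a| >= |x| (1 - 2|a|). *)
    rewrite <- (pow2_abs x). nra. }
  assert (H0 : Cmod (gterm a b tau 0) = K).
  { unfold gterm. rewrite Cmod_cexp. unfold Re at 1; cbn [fst]. unfold K. f_equal. ring. }
  pose proof (sumZ_tail _ K r 1 ltac:(lra) Hd) as Htail.
  fold (Theta a b tau) in Htail. rewrite E in Htail. cbn [psumZ] in Htail.
  pose proof (Hd (-1)%Z) as H1. change (Z.abs_nat (-1)) with 1%nat in H1.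
  rewrite pow_1 in Htail, H1.
  change (- Z.of_nat 1)%Z with (-1)%Z in Htail. change (Z.of_nat 0) with 0%Z in Htail.
  set (g0 := gterm a b tau 0) in *. set (g1 := gterm a b tau (-1)) in *.
  replace (Cminus (RtoC 0) (Cplus (RtoC 0) (Cplus g0 g1))) with (Copp (Cplus g0 g1))
    in Htail by ring.
  rewrite Cmod_opp in Htail.
  assert (H2 : Cmod g0 <= Cmod (Cplus g0 g1) + Cmod g1).
  { replace g0 with (Cplus (Cplus g0 g1) (Copp g1)) at 1 by ring.
    eapply Rle_trans; [apply Cmod_triangle|]. rewrite Cmod_opp. lra. }
  (* From r <= 1/10, 4r/(1 - r) <= 4/9. *)
  assert (H3 : 4 * (K / (1 - r)) * r <= K / 2).
  { replace (4 * (K / (1 - r)) * r) with (K * (4 * r / (1 - r))) by (field; lra).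
    unfold Rdiv at 2. apply Rmult_le_compat_l; [lra|].
    apply Rmult_le_reg_r with (1 - r); [lra|].
    replace (4 * r / (1 - r) * (1 - r)) with (4 * r) by (field; lra). lra. }
  assert (H4 : K * r <= K * (1 / 10)) by (apply Rmult_le_compat_l; lra).
  lra.
Qed.

Fixpoint dbln (k : nat) (tau : C) : C :=
  match k with O => tau | S j => dbl (dbln j tau) end.

Lemma Im_dbln k tau : Im (dbln k tau) = 2 ^ k * Im tau.
Proof.
  induction k as [|k IH]; cbn [dbln]; [simpl; ring|].
  change (Im (dbl (dbln k tau))) with (2 * Im (dbln k tau)). rewrite IH. simpl. ring.
Qed.

Lemma Im_dbln_pos k tau : 0 < Im tau -> 0 < Im (dbln k tau).
Proof.
  intro Ht. rewrite Im_dbln. apply Rmult_lt_0_compat; [apply pow_lt; lra|exact Ht].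
Qed.

(** The exponent k is uniform in b, because doubling tau changes b at every step of the
    propagation. *)
Lemma Theta_dbln_neq0 a tau :
  Rabs a < 1 / 2 -> 0 < Im tau -> exists k, forall b, Theta a b (dbln k tau) <> RtoC 0.
Proof.
  intros Ha Ht. pose proof PI_RGT_0 as Hpi.
  set (x := PI * Im tau * (1 - 2 * Rabs a)).
  assert (Hx : 0 < x)
    by (unfold x; apply Rmult_lt_0_compat; [apply Rmult_lt_0_compat; assumption|lra]).
  (* The bound 9 suffices since exp y >= 1 + y >= 10 once y >= 9. *)
  destruct (Pow_x_infinity 2 ltac:(rewrite Rabs_pos_eq; lra) (9 / x)) as [k Hk].
  specialize (Hk k (le_n k)). rewrite Rabs_pos_eq in Hk by (apply pow_le; lra).
  exists k. intro b. apply Theta_neq0_large_Im; [exact Ha|apply Im_dbln_pos; exact Ht|].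
  rewrite Im_dbln.
  replace (PI * (2 ^ k * Im tau) * (1 - 2 * Rabs a)) with (2 ^ k * x) by (unfold x; ring).
  assert (H9 : 9 <= 2 ^ k * x).
  { apply Rge_le in Hk. apply (Rmult_le_compat_r x) in Hk; [|lra].
    replace (9 / x * x) with 9 in Hk by (field; lra). exact Hk. }
  rewrite exp_Ropp. replace (1 / 10) with (/ 10) by field.
  apply Rinv_le_contravar; [lra|].
  pose proof (exp_ineq1_le (2 ^ k * x)). lra.
Qed.

(** At a = b = 0 the right side of [Theta_dbl] is the square of this same constant at 2 tau, so a
    zero propagates without any cancellation. This case comes first because the general one cancels
    this factor. *)
Lemma Theta_0_half_neq0 tau : 0 < Im tau -> Theta 0 (1 / 2) tau <> RtoC 0.
Proof.
  intros Ht E.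
  destruct (Theta_dbln_neq0 0 tau ltac:(rewrite Rabs_R0; lra) Ht) as [k Hk].
  apply (Hk (1 / 2)). clear Hk. induction k as [|k IH]; [exact E|]. cbn [dbln].
  pose proof (Theta_dbl 0 0 _ (Im_dbln_pos k tau Ht)) as D.
  rewrite !Rplus_0_l, Rmult_0_r, !Rplus_0_l, IH, Cmult_0_r in D.
  symmetry in D. destruct (Ceq_dec (Theta 0 (1 / 2) (dbl (dbln k tau))) (RtoC 0)) as [Z|NZ];
    [exact Z|]. exfalso. exact (Cmult_neq_0 _ _ NZ NZ D).
Qed.

Lemma Theta_neq0 a b tau : Rabs a < 1 / 2 -> 0 < Im tau -> Theta a b tau <> RtoC 0.
Proof.
  intros Ha Ht E.
  destruct (Theta_dbln_neq0 a tau Ha Ht) as [k Hk].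
  enough (Hz : exists b', Theta a b' (dbln k tau) = RtoC 0)
    by (destruct Hz as [b' Hb]; exact (Hk b' Hb)).
  clear Hk. induction k as [|k [b' IH]]; [exists b; exact E|]. cbn [dbln].
  exists (2 * b' + 1 / 2).
  pose proof (Theta_dbl a b' _ (Im_dbln_pos k tau Ht)) as D.
  rewrite IH, Cmult_0_l in D. symmetry in D.
  pose proof (Theta_0_half_neq0 _ (Im_dbl_pos _ (Im_dbln_pos k tau Ht))) as N0.
  destruct (Ceq_dec (Theta a (2 * b' + 1 / 2) (dbl (dbln k tau))) (RtoC 0)) as [Z|NZ];
    [exact Z|]. exfalso. exact (Cmult_neq_0 _ _ NZ N0 D).
Qed.

(** * The two relations at 5-torsion points *)

Lemma Cmult_to_Cdiv x y z : y <> RtoC 0 -> Cmult x y = z -> x = Cdiv z y.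
Proof.
  intros Hy <-. field. exact Hy.
Qed.

Lemma cube_neq0 z : z <> RtoC 0 -> cube z <> RtoC 0.
Proof.
  intro Hz. unfold cube. repeat apply Cmult_neq_0; exact Hz.
Qed.

Lemma zeta5_phase : zeta5 = phase (1 / 5).
Proof.
  unfold zeta5, phase. f_equal. unfold Cmult, RtoC, Ci; cbn [fst snd]. f_equal; field.
Qed.

Lemma Theta_shift_b_opp a b tau : 0 < Im tau -> Theta a b tau = Cmult (phase (- a)) (Theta a (b + 1) tau).
Proof.
  intro Ht. rewrite Theta_shift_b by exact Ht.
  transitivity (Cmult (Cmult (phase (- a)) (phase a)) (Theta a b tau)); [|ring].
  rewrite phase_opp. ring.
Qed.

Lemma Theta_reflect a b tau : 0 < Im tau -> Theta (1 - a) b tau = Theta a (- b) tau.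
Proof.
  intro Ht. rewrite <- Theta_opp, <- Theta_shift_a by exact Ht. f_equal. ring.
Qed.

(** Take x = (2/5, 1/5) and y = (-3/5, -2/5). Up to phases, x - y gives theta[1; 1/5] and x + y
    gives d_3; 2x + y and y give d_5 and c_9; x + 2y and x give d_1 and c_3. *)
Lemma quartic_relation_1 tau :
  0 < Im tau ->
  Cmult (thetac 1 (1 / 5) tau) (cube (dth 3 tau)) =
  Cmult zeta5 (Cplus (Cmult (Cmult zeta5 (cube (cth 9 tau))) (dth 5 tau))
                     (Cmult (cube (cth 3 tau)) (dth 1 tau))).
Proof.
  intro Ht. unfold dth, cth. rewrite !thetac_Theta, zeta5_phase.
  pose proof (three_term_cube (2 / 5) (1 / 5) (- 3 / 5) (- 2 / 5) tau Ht) as E. unfold Theta1 in E.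
  replace (Theta (2 / 5 + -3 / 5 + 1 / 2) (1 / 5 + -2 / 5 + 1 / 2) tau)
    with (Theta (3 / 5 / 2) (3 / 5 / 2) tau) in E by (f_equal; field).
  replace (Theta (2 / 5 - -3 / 5 + 1 / 2) (1 / 5 - -2 / 5 + 1 / 2) tau)
    with (Theta (1 / 2 + 1) (1 / 5 / 2 + 1) tau) in E by (f_equal; field).
  replace (Theta (2 * (2 / 5) + -3 / 5 + 1 / 2) (2 * (1 / 5) + -2 / 5 + 1 / 2) tau)
    with (Theta (1 - 3 / 5 / 2) (1 / 2) tau) in E by (f_equal; field).
  replace (Theta (-3 / 5 + 1 / 2) (-2 / 5 + 1 / 2) tau)
    with (Theta (- (1 / 5 / 2)) (- (- (1 / 10))) tau) in E by (f_equal; field).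
  replace (Theta (2 / 5 + 2 * (-3 / 5) + 1 / 2) (1 / 5 + 2 * (-2 / 5) + 1 / 2) tau)
    with (Theta (- (3 / 5 / 2)) (- (1 / 5 / 2)) tau) in E by (f_equal; field).
  replace (Theta (2 / 5 + 1 / 2) (1 / 5 + 1 / 2) tau)
    with (Theta (1 - 1 / 5 / 2) (7 / 10) tau) in E by (f_equal; field).
  rewrite Theta_shift_a, Theta_shift_b, phase_half, !Theta_opp, !Theta_reflect in E by exact Ht.
  (* Negative second characteristics are raised by one period to the representatives k/5 with k = 5,
     9, 3, each at the cost of a phase. *)
  rewrite (Theta_shift_b_opp _ (- (1 / 2))), (Theta_shift_b_opp _ (- (1 / 10))),
    (Theta_shift_b_opp _ (- (7 / 10))) in E by exact Ht.
  replace (- (1 / 2) + 1) with (5 / 5 / 2) in E by field.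
  replace (- (1 / 10) + 1) with (9 / 5 / 2) in E by field.
  replace (- (7 / 10) + 1) with (3 / 5 / 2) in E by field.
  set (A := Theta (1 / 2) _ tau) in *. set (D3 := Theta (3 / 5 / 2) (3 / 5 / 2) tau) in *.
  set (D5 := Theta (3 / 5 / 2) (5 / 5 / 2) tau) in *. set (C9 := Theta (1 / 5 / 2) (9 / 5 / 2) tau) in *.
  set (D1 := Theta (3 / 5 / 2) (1 / 5 / 2) tau) in *. set (C3 := Theta (1 / 5 / 2) (3 / 5 / 2) tau) in *.
  assert (P1 : Cmult (phase (2 / 5)) (phase (- (2 / 5))) = RtoC 1).
  { rewrite <- phase_plus, <- phase_0. f_equal. field. }
  assert (P2 : Cmult (phase (2 / 5)) (Cmult (phase (- (- 3 / 5))) (Cmult (phase (- (3 / 5 / 2)))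
             (cube (phase (- (1 / 5 / 2)))))) = Cmult (phase (1 / 5)) (phase (1 / 5))).
  { unfold cube. rewrite <- !phase_plus. f_equal. field. }
  (* The angle is -3/10 = -1/2 + 1/5; the half turn supplies the sign that turns the difference
     below into a sum. *)
  assert (P3 : cube (phase (- (1 / 5 / 2))) = Copp (phase (1 / 5))).
  { transitivity (Cmult (phase (- (1 / 2))) (phase (1 / 5))).
    - unfold cube. rewrite <- !phase_plus. f_equal. field.
    - assert (Q : phase (- (1 / 2)) = RtoC (-1)).
      { transitivity (Cmult (phase (-1)) (phase (1 / 2))).
        - rewrite <- phase_plus. f_equal. field.
        - rewrite phase_half. change (-1) with (IZR (-1)) at 1. rewrite phase_Z. ring. }
      rewrite Q. change (RtoC (-1)) with (RtoC (- (1))). rewrite RtoC_opp. ring. }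
  change (RtoC (-1)) with (RtoC (- (1))) in E. rewrite RtoC_opp in E.
  set (x := phase (2 / 5)) in *. set (y := phase (- (2 / 5))) in *.
  set (w := phase (- (- 3 / 5))) in *. set (s := phase (- (3 / 5 / 2))) in *.
  set (t := phase (- (1 / 5 / 2))) in *. set (z := phase (1 / 5)) in *.
  transitivity (Cmult (Cmult x y) (Cmult A (cube D3))); [rewrite P1; ring|].
  apply (f_equal (Cmult x)) in E.
  transitivity (Cminus (Cmult (Cmult x (Cmult w (Cmult s (cube t)))) (Cmult D5 (cube C9)))
                       (Cmult (Cmult (Cmult x y) (cube t)) (Cmult D1 (cube C3)))).
  - match type of E with ?l = ?r =>
      transitivity (Cplus (Cminus l r) (Cmult (Cmult x y) (Cmult A (cube D3)))) end.
    + rewrite E. ring.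
    + unfold cube. ring.
  - rewrite P2, P1, P3. unfold cube. ring.
Qed.

(** Take x = (-1/5, 1/5) and y = (-1/5, -3/5). Up to phases, x - y gives theta[1; 3/5] and x + y
    gives c_1; 2x + y and y give c_7 and d_9; x + 2y and x give c_5 and d_7. Equal first coordinates
    make the leading phases agree, and the others multiply to 1. *)
Lemma quartic_relation_2 tau :
  0 < Im tau ->
  Cmult (thetac 1 (3 / 5) tau) (cube (cth 1 tau)) =
  Cplus (Copp (Cmult (cube (dth 7 tau)) (cth 5 tau))) (Cmult (cube (dth 9 tau)) (cth 7 tau)).
Proof.
  intro Ht. unfold dth, cth. rewrite !thetac_Theta.
  pose proof (three_term_cube (- 1 / 5) (1 / 5) (- 1 / 5) (- 3 / 5) tau Ht) as E. unfold Theta1 in E.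
  replace (Theta (-1 / 5 + -1 / 5 + 1 / 2) (1 / 5 + -3 / 5 + 1 / 2) tau)
    with (Theta (1 / 5 / 2) (1 / 5 / 2) tau) in E by (f_equal; field).
  replace (Theta (-1 / 5 - -1 / 5 + 1 / 2) (1 / 5 - -3 / 5 + 1 / 2) tau)
    with (Theta (1 / 2) (3 / 5 / 2 + 1) tau) in E by (f_equal; field).
  replace (Theta (2 * (-1 / 5) + -1 / 5 + 1 / 2) (2 * (1 / 5) + -3 / 5 + 1 / 2) tau)
    with (Theta (- (1 / 5 / 2)) (- (- (3 / 10))) tau) in E by (f_equal; field).
  replace (Theta (-1 / 5 + 1 / 2) (-3 / 5 + 1 / 2) tau)
    with (Theta (3 / 5 / 2) (- (1 / 10)) tau) in E by (f_equal; field).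
  replace (Theta (-1 / 5 + 2 * (-1 / 5) + 1 / 2) (1 / 5 + 2 * (-3 / 5) + 1 / 2) tau)
    with (Theta (- (1 / 5 / 2)) (- (5 / 5 / 2)) tau) in E by (f_equal; field).
  replace (Theta (-1 / 5 + 1 / 2) (1 / 5 + 1 / 2) tau)
    with (Theta (3 / 5 / 2) (7 / 5 / 2) tau) in E by (f_equal; field).
  rewrite Theta_shift_b, phase_half, !Theta_opp in E by exact Ht.
  rewrite (Theta_shift_b_opp _ (- (3 / 10))), (Theta_shift_b_opp _ (- (1 / 10))) in E by exact Ht.
  replace (- (3 / 10) + 1) with (7 / 5 / 2) in E by field.
  replace (- (1 / 10) + 1) with (9 / 5 / 2) in E by field.
  set (A := Theta (1 / 2) _ tau) in *. set (C1 := Theta (1 / 5 / 2) (1 / 5 / 2) tau) in *.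
  set (C7 := Theta (1 / 5 / 2) (7 / 5 / 2) tau) in *. set (D9 := Theta (3 / 5 / 2) (9 / 5 / 2) tau) in *.
  set (C5 := Theta (1 / 5 / 2) (5 / 5 / 2) tau) in *. set (D7 := Theta (3 / 5 / 2) (7 / 5 / 2) tau) in *.
  assert (P1 : Cmult (phase (- 1 / 5)) (phase (- (- 1 / 5))) = RtoC 1).
  { rewrite <- phase_plus, <- phase_0. f_equal. field. }
  assert (P2 : Cmult (phase (- (1 / 5 / 2))) (cube (phase (- (3 / 5 / 2)))) = RtoC 1).
  { unfold cube. rewrite <- !phase_plus, <- (phase_Z (-1)). f_equal. simpl. field. }
  change (RtoC (-1)) with (RtoC (- (1))) in E. rewrite RtoC_opp in E.
  set (x := phase (- 1 / 5)) in *. set (y := phase (- (- 1 / 5))) in *.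
  set (s := phase (- (3 / 5 / 2))) in *. set (t := phase (- (1 / 5 / 2))) in *.
  transitivity (Cmult (Cmult x y) (Cmult A (cube C1))); [rewrite P1; ring|].
  apply (f_equal (Cmult x)) in E.
  transitivity (Cmult (Cmult x y) (Cminus (Cmult (Cmult t (cube s)) (Cmult C7 (cube D9)))
                                          (Cmult C5 (cube D7)))).
  - match type of E with ?l = ?r =>
      transitivity (Cplus (Cminus l r) (Cmult (Cmult x y) (Cmult A (cube C1)))) end.
    + rewrite E. ring.
    + unfold cube. ring.
  - rewrite P2, P1. unfold cube. ring.
Qed.

Theorem theorem5p2 (tau : C) (Htau : 0 < Im tau) :
  thetac 1 (1/5) tau =
    Cmult zeta5
      (Cdiv (Cplus (Cmult (Cmult zeta5 (cube (cth 9 tau))) (dth 5 tau))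
                   (Cmult (cube (cth 3 tau)) (dth 1 tau)))
            (cube (dth 3 tau)))
  /\
  thetac 1 (3/5) tau =
    Cdiv (Cplus (Copp (Cmult (cube (dth 7 tau)) (cth 5 tau)))
                (Cmult (cube (dth 9 tau)) (cth 7 tau)))
         (cube (cth 1 tau)).
Proof.
  split.
  - assert (N : cube (dth 3 tau) <> RtoC 0).
    { apply cube_neq0. unfold dth. rewrite thetac_Theta.
      apply Theta_neq0; [rewrite Rabs_pos_eq; lra|exact Htau]. }
    rewrite (Cmult_to_Cdiv _ _ _ N (quartic_relation_1 tau Htau)).
    unfold Cdiv. ring.
  - apply Cmult_to_Cdiv; [|apply quartic_relation_2; exact Htau].
    apply cube_neq0. unfold cth. rewrite thetac_Theta.
    apply Theta_neq0; [rewrite Rabs_pos_eq; lra|exact Htau].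
Qed.
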